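(* Let $\mathbb{W}=\{w\in\mathbb{R}^{n_x}\mid Vw\le\bm{1}\}$, with $V\in\mathbb{R}^{n_v\times n_x}$, be a compact convex polytope, let $(A,B)$ be stabilisable, and let $\Phi=A+BK$, where the fixed gain $K$ is such that $\Phi$ is strictly stable. Let the finite integer $r$ and $\rho\in[0,1)$ be such that $\Phi^r\mathbb{W}\subseteq\rho\mathbb{W}$, and let $$\mathbb{S}=\frac{1}{1-\rho}\bigoplus_{i=0}^{r-1}\Phi^i\mathbb{W}.$$ Let $v^\star_k\in\mathbb{W}$, $\alpha^\star_k\in[0,1]$ and $\hat{\mathbb{W}}^\star_k=\mathcal{W}(v^\star_k,\alpha^\star_k)$. Then the set $$\hat{\mathbb{S}}^\star_k=\alpha^\star_k\mathbb{S}\oplus(1-\alpha^\star_k)(I-\Phi)^{-1}v^\star_k$$ satisfies $\Phi\hat{\mathbb{S}}^\star_k\oplus\hat{\mathbb{W}}^\star_k\subseteq\hat{\mathbb{S}}^\star_k$.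
   Context: $\oplus$ is the Minkowski sum, and a vector is identified with the singleton containing it. ''Strictly stable'' means all eigenvalues lie strictly inside the unit disc. $A\in\mathbb{R}^{n_x\times n_x}$, $B\in\mathbb{R}^{n_x\times n_u}$, $K\in\mathbb{R}^{n_u\times n_x}$. For $v\in\mathbb{W}$ and $\alpha\in[0,1]$, $\mathcal{W}(v,\alpha):=(1-\alpha)v\oplus\alpha\mathbb{W}$. It is known (Raković et al.) that such $r$ and $\rho$ exist and that $\mathbb{S}$ is convex and compact with $\Phi\mathbb{S}\oplus\mathbb{W}\subseteq\mathbb{S}$ and $\bigoplus_{i=0}^\infty\Phi^i\mathbb{W}\subseteq\mathbb{S}$. *)

(* Defs.v *)
From HB Require Import structures.
From mathcomp Require Import all_boot all_order all_algebra.
From mathcomp Require Import all_classical all_reals all_analysis.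
From mathcomp Require Import complex.

Set Implicit Arguments.
Unset Strict Implicit.
Unset Printing Implicit Defensive.

Import Order.TTheory GRing.Theory Num.Theory.
Import numFieldNormedType.Exports.

Local Open Scope classical_set_scope.
Local Open Scope ring_scope.

(* The eigenvalues of the real matrix are taken in the complex numbers; the
   norm on [complex R] is the modulus, viewed as a complex number. *)
Definition strictly_stable (R : realType) (n : nat) (M : 'M[R]_n) : Prop :=
  forall z : complex R,
    eigenvalue (map_mx (real_complex R) M) z -> `|z| < 1.

(* Stabilisability of the discrete-time pair by a static state feedback. *)
Definition stabilisable (R : realType) (n m : nat) (A : 'M[R]_n)
    (B : 'M[R]_(n, m)) : Prop :=
  exists K : 'M[R]_(m, n), strictly_stable (A + B *m K).

Definition minkowski_sum (R : realType) (n : nat) (X Y : set 'cV[R]_n) : set 'cV[R]_n :=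
  [set x + y | x in X & y in Y].

(* An empty sum is {0}, the neutral element of the Minkowski sum. *)
Definition big_minkowski_sum (R : realType) (n r : nat) (X : nat -> set 'cV[R]_n) :
    set 'cV[R]_n :=
  \big[@minkowski_sum R n/[set 0]]_(i < r) X i.

Definition scale_set (R : realType) (n : nat) (a : R) (X : set 'cV[R]_n) :
    set 'cV[R]_n :=
  [set a *: x | x in X].

Definition mulmx_set (R : realType) (m n : nat) (M : 'M[R]_(m, n))
    (X : set 'cV[R]_n) : set 'cV[R]_m :=
  [set M *m x | x in X].

(* [V w <= 1] componentwise.  Such a set is convex and contains 0, but may be
   unbounded: compactness has to be assumed separately. *)
Definition polytope (R : realType) (p n : nat) (V : 'M[R]_(p, n)) :
    set 'cV[R]_n :=
  [set w | forall i, (V *m w) i 0 <= 1].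

Definition scaled_disturbance (R : realType) (n : nat) (W : set 'cV[R]_n)
    (v : 'cV[R]_n) (alpha : R) : set 'cV[R]_n :=
  minkowski_sum [set (1 - alpha) *: v] (scale_set alpha W).

Definition rakovic_set (R : realType) (n : nat) (Phi : 'M[R]_n)
    (W : set 'cV[R]_n) (r : nat) (rho : R) : set 'cV[R]_n :=
  scale_set (1 - rho)^-1 (big_minkowski_sum r (fun i => mulmx_set (Phi ^+ i) W)).

(* The inverse is the true one when [Phi] is strictly stable, since 1 is then
   not an eigenvalue of [Phi]. *)
Definition tube_section (R : realType) (n : nat) (Phi : 'M[R]_n)
    (S : set 'cV[R]_n) (v : 'cV[R]_n) (alpha : R) : set 'cV[R]_n :=
  minkowski_sum (scale_set alpha S)
       [set (1 - alpha) *: (invmx (1%:M - Phi) *m v)].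

(* Main.v *)
(** Phi S + W is contained in S: in Phi S the last summand lands in
    Phi^r W, hence in rho W, and rho W + (1 - rho) W is contained in W by
    convexity, so it can take the vacated place of index 0.  When r = 0 the
    set S is {0} and this shift is impossible, but then W is contained in
    rho W, and compactness forces W = {0}.
    The translated tube follows from the affine fixed-point equation
    Phi (I - Phi)^-1 v + v = (I - Phi)^-1 v. *)
Require Import Defs.
From HB Require Import structures.
From mathcomp Require Import all_boot all_order all_algebra.
From mathcomp Require Import all_classical all_reals all_analysis.
From mathcomp Require Import complex.

Set Implicit Arguments.
Unset Strict Implicit.
Unset Printing Implicit Defensive.

Import Order.TTheory GRing.Theory Num.Theory.
Import numFieldNormedType.Exports.

Local Open Scope classical_set_scope.
Local Open Scope ring_scope.

(** A nonzero row vector in the kernel of [1%:M - M] would be an eigenvector of [M] for the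
    eigenvalue 1, whose modulus is not below 1. *)
Lemma strictly_stable_unitmx (R : realType) (n : nat) (M : 'M[R]_n) :
  strictly_stable M -> 1%:M - M \in unitmx.
Proof.
move=> stM; rewrite -row_free_unit -kermx_eq0; apply: contraT.
case/rowV0Pn=> u /sub_kermxP; rewrite mulmxBr mulmx1 => /subr0_eq uM u_neq0.
have /stM : eigenvalue (map_mx (real_complex R) M) (real_complex R 1).
  by rewrite eigenvalue_map; apply/eigenvalueP; exists u; rewrite // scale1r.
by rewrite rmorph1 normr1 ltxx.
Qed.

(** The summands form a function on [nat], free beyond [r], so that shifting indices needs no
    ordinal casts. *)
Lemma big_minkowski_sumP (R : realType) (n r : nat) (X : nat -> set 'cV[R]_n)
    (x : 'cV[R]_n) :
  big_minkowski_sum r X x <->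
  exists2 f : nat -> 'cV[R]_n,
    (forall i, (i < r)%N -> X i (f i)) & x = \sum_(i < r) f i.
Proof.
rewrite /big_minkowski_sum; elim: r X x => [|r IH] X x.
  rewrite big_ord0; split=> [->|[f _]]; last by rewrite big_ord0.
  by exists (fun=> 0); rewrite ?big_ord0.
rewrite big_ord_recl; split=> [[y Xy [z Xz <-]]|[f Xf ->]].
  have /(IH (fun i => X i.+1)) [f Xf ->] := Xz.
  exists (fun i => if i is j.+1 then f j else y).
    by case=> [|i] //; rewrite ltnS; apply: Xf.
  by rewrite big_ord_recl.
rewrite big_ord_recl; exists (f 0%N); first exact: Xf.
exists (\sum_(i < r) f i.+1) => //.
by apply/(IH (fun i => X i.+1)); exists (fun i => f i.+1) => // i; apply: (Xf i.+1).
Qed.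

Lemma polytope_convex (R : realType) (p n : nat) (V : 'M[R]_(p, n))
    (a : R) (x y : 'cV[R]_n) :
  0 <= a <= 1 -> polytope V x -> polytope V y ->
  polytope V (a *: x + (1 - a) *: y).
Proof.
move=> /andP[a_ge0 a_le1] Vx Vy i.
rewrite mulmxDr -!scalemxAr mxE [X in X + _]mxE [X in _ + X]mxE.
(* The bound 1 becomes [a * 1 + (1 - a) * 1], to be compared term by term. *)
rewrite -[leRHS](subrKC a) -[X in _ <= X + _]mulr1 -[X in _ <= _ + X]mulr1.
by apply: lerD; apply: ler_wpM2l; rewrite ?subr_ge0.
Qed.

(** A point [c] of maximal norm in [W] is [rho] times a point of [W], so its norm is at most [rho]
    times itself and must vanish. *)
Lemma compact_sub_scale_eq0 (R : realType) (n : nat) (W : set 'cV[R]_n)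
    (rho : R) :
  compact W -> 0 <= rho < 1 -> W `<=` scale_set rho W -> W `<=` [set 0].
Proof.
move=> cW /andP[rho_ge0 rho_lt1] Wrho x Wx.
have [|c /set_mem Wc max_c] := compact_EVT_max (f := fun y => `|y|) (ex_intro _ x Wx) cW.
  by apply: continuous_subspaceT; apply: norm_continuous.
have c0 : `|c| <= 0.
  have [y Wy cE] := Wrho _ Wc.
  have : `|c| <= rho * `|c|.
    by rewrite -{1}cE normrZ ger0_norm // ler_wpM2l // max_c // mem_set.
  by rewrite -subr_ge0 -{2}[`|c|]mul1r -mulrBl nmulr_rge0 // subr_lt0.
by apply/eqP; rewrite -normr_le0 (le_trans _ c0) // max_c // mem_set.
Qed.

Lemma rakovic_set_invariant (R : realType) (p n : nat) (V : 'M[R]_(p, n))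
    (Phi : 'M[R]_n) (r : nat) (rho : R) :
  let W := polytope V in
  compact W -> 0 <= rho < 1 ->
  mulmx_set (Phi ^+ r) W `<=` scale_set rho W ->
  let S := rakovic_set Phi W r rho in
  minkowski_sum (mulmx_set Phi S) W `<=` S.
Proof.
move=> W cW rho01 PhirW S _ [_ [_ [z /big_minkowski_sumP[f Wf ->] <-] <-] [w Ww <-]].
case: r PhirW @S Wf => [|r] PhirW /= Wf.
  have W0 : W `<=` [set 0].
    apply: (compact_sub_scale_eq0 cW rho01) => y Wy.
    by apply: PhirW; exists y; rewrite // expr0 mul1mx.
  rewrite (W0 _ Ww) big_ord0 scaler0 mulmx0 addr0.
  exists 0; rewrite ?scaler0 //.
  by apply/big_minkowski_sumP; exists (fun=> 0); rewrite ?big_ord0.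
have [g Wg fE] : exists2 g : nat -> 'cV[R]_n, forall i, (i < r.+1)%N -> W (g i) &
    forall i, (i < r.+1)%N -> f i = Phi ^+ i *m g i.
  have /boolp.choice[g gP] i : exists y, (i < r.+1)%N -> W y /\ f i = Phi ^+ i *m y.
    (* Choice needs a value at every index; 0 is a dummy out of range. *)
    case: (ltnP i r.+1) => [/Wf[y Wy <-]|_]; first by exists y.
    by exists 0.
  by exists g => i /gP[].
have [w' Ww' w'E] : scale_set rho W (Phi ^+ r.+1 *m g r).
  by apply: PhirW; exists (g r); rewrite //; apply: Wg.
have rho_neq1 : 1 - rho != 0 by rewrite gt_eqF // subr_gt0; case/andP: rho01.
(* Multiplication by [Phi] moves each summand up one index. The overflow at [r.+1] is [rho *: w'];
   it joins [w] at index 0, where [w] has weight [1 - rho] because the whole sum is divided by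
   [1 - rho]. *)
pose h i := if i is j.+1 then Phi ^+ i *m g j else rho *: w' + (1 - rho) *: w.
exists (\sum_(i < r.+1) h i).
  apply/big_minkowski_sumP; exists h => // -[_|i]; rewrite /h.
    exists (rho *: w' + (1 - rho) *: w); last by rewrite expr0 mul1mx.
    by apply: polytope_convex => //; case/andP: rho01 => -> /ltW.
  by move=> ir; exists (g i); rewrite //; apply/Wg/ltnW.
have PhiE i : (i < r.+1)%N -> Phi *m f i = Phi ^+ i.+1 *m g i.
  by move=> ir; rewrite fE // mulmxA exprS.
rewrite big_ord_recl /= -scalemxAr mulmx_sumr big_ord_recr /= PhiE // -w'E.
rewrite [in RHS](eq_bigr (fun i : 'I_r => Phi ^+ i.+1 *m g i)) => [|i _]; last first.
  by rewrite PhiE // ltnS ltnW.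
rewrite -[X in _ = _ + X](scalerK rho_neq1) -scalerDr; congr (_ *: _).
by rewrite [LHS]addrC addrA.
Qed.

Theorem proposition5 (R : realType) (nx nu nv : nat)
    (V : 'M[R]_(nv, nx)) (A : 'M[R]_nx) (B : 'M[R]_(nx, nu))
    (K : 'M[R]_(nu, nx)) (r : nat) (rho : R)
    (v : 'cV[R]_nx) (alpha : R) :
  let W := polytope V in
  let Phi := A + B *m K in
  compact W ->
  stabilisable A B ->
  strictly_stable Phi ->
  0 <= rho < 1 ->
  mulmx_set (Phi ^+ r) W `<=` scale_set rho W ->
  v \in W ->
  0 <= alpha <= 1 ->
  let S := rakovic_set Phi W r rho in
  let What := scaled_disturbance W v alpha in
  let Shat := tube_section Phi S v alpha in
  minkowski_sum (mulmx_set Phi Shat) What `<=` Shat.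
Proof.
move=> W Phi cW _ stPhi rho01 PhirW _ alpha01 S What Shat.
move=> _ [_ [_ [_ [s Ss <-] [_ -> <-]] <-] [_ [_ -> [_ [w Ww <-] <-]] <-]].
pose u := invmx (1%:M - Phi) *m v.
have uE : Phi *m u + v = u.
  have <- : (1%:M - Phi) *m u = v by rewrite mulKVmx ?strictly_stable_unitmx.
  by rewrite mulmxBl mul1mx addrC subrK.
(* The [alpha] part uses the invariance of [S]; the [1 - alpha] part stays at the fixed point [u] of
   the map sending [x] to [Phi *m x + v]. *)
exists (alpha *: (Phi *m s + w)).
  exists (Phi *m s + w) => //.
  apply: (rakovic_set_invariant cW rho01 PhirW).
  by exists (Phi *m s); [exists s|exists w].
exists ((1 - alpha) *: u) => //.
(* Only the [u] on the left is expanded, which makes both sides the same four terms. *)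
rewrite -/u -{1}uE mulmxDr -!scalemxAr !scalerDr.
by rewrite [in RHS](addrC _ (alpha *: w)) [RHS]addrACA.
Qed.
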